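(* Let $\mathcal{R}>0$, $\alpha>0$, $\beta>0$ be fixed, and let $\bar\gamma_{\mathrm{D}}>0$ with $\bar\gamma_{\mathrm{R}}=\alpha\bar\gamma_{\mathrm{D}}$ and $\bar\gamma_{\mathrm{E}}=\bar\gamma_{\mathrm{R}}/\beta$. Let $h_{\mathrm{S},\mathrm{R}},h_{\mathrm{R},\mathrm{D}},h_{\mathrm{S},\mathrm{E}},h_{\mathrm{R},\mathrm{E}}$ be independent $\mathcal{CN}(0,1)$ random variables, and define $$\mathcal{R}^{3}_{\mathrm{S}\to\mathrm{R}}=\log_2\frac{1+\bar\gamma_{\mathrm{R}}|h_{\mathrm{S},\mathrm{R}}|^2}{1+\bar\gamma_{\mathrm{E}}|h_{\mathrm{S},\mathrm{E}}|^2},\qquad \mathcal{R}^{3}_{\mathrm{R}\to\mathrm{D}}=\log_2\frac{1+\bar\gamma_{\mathrm{D}}|h_{\mathrm{R},\mathrm{D}}|^2}{1+\bar\gamma_{\mathrm{E}}|h_{\mathrm{R},\mathrm{E}}|^2},$$ $\mathcal{R}_3=\max\{\min\{\mathcal{R}^{3}_{\mathrm{S}\to\mathrm{R}},\mathcal{R}^{3}_{\mathrm{R}\to\mathrm{D}}\},0\}$ and $\mathcal{P}_3=\Pr(\mathcal{R}_3<\mathcal{R})$. Then as $\bar\gamma_{\mathrm{D}}\to\infty$, $$\mathcal{P}_3\approx\mathcal{P}_3^{\lim}+\hat{\mathcal{M}}_3\bar\gamma_{\mathrm{D}}^{-1},$$ in the sense that $\mathcal{P}_3\to\mathcal{P}_3^{\lim}$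 and $\bar\gamma_{\mathrm{D}}(\mathcal{P}_3-\mathcal{P}_3^{\lim})\to\hat{\mathcal{M}}_3$, where $$\mathcal{P}_3^{\lim}=1-\frac{\beta}{\beta+\alpha 2^{\mathcal{R}}}\cdot\frac{\beta}{\beta+2^{\mathcal{R}}},\qquad \hat{\mathcal{M}}_3=\frac{(2^{\mathcal{R}}-1)(1+1/\alpha)}{\left(1+\frac{\alpha}{\beta}2^{\mathcal{R}}\right)\left(1+\frac{1}{\beta}2^{\mathcal{R}}\right)}.$$
   Context: $\mathcal{CN}(0,1)$ denotes a circularly symmetric complex Gaussian random variable with zero mean and unit variance (Rayleigh fading). The quantities model a decode-and-forward relay system where the eavesdropper overhears both source and relay; $\bar\gamma$'s are average SNRs, $\mathcal{R}_3$ the secrecy capacity and $\mathcal{P}_3$ the secrecy outage probability. *)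

(* Defs.v *)
From HB Require Import structures.
From mathcomp Require Import all_boot all_order all_algebra.
From mathcomp Require Import all_classical all_reals all_analysis.
Set Implicit Arguments. Unset Strict Implicit. Unset Printing Implicit Defensive.
Import Order.TTheory GRing.Theory Num.Theory.
Import numFieldNormedType.Exports.
Local Open Scope classical_set_scope.
Local Open Scope ring_scope.

Section defs.
Context {d : measure_display} {T : measurableType d} {R : realType}.

(* mutual independence of a finite list of real random variables:
   product rule for every choice of Borel sets (choosing [setT] for some
   indices gives the product rule for every sub-family). *)
Definition mutually_independent (P : probability T R) (s : seq (T -> R)) : Prop :=
  forall B : nat -> set R, (forall i, measurable (B i)) ->
    P (\bigcap_(i in `I_(size s)) (nth (fun _ : T => 0%R) s i @^-1` B i)) =
    (\prod_(i < size s) P (nth (fun _ : T => 0%R) s i @^-1` B i))%E.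

(* h = x + i y is CN(0,1): real and imaginary parts are N(0, 1/2)
   (standard deviation sqrt(1/2)); their independence is part of the
   mutual independence hypothesis of the theorem. *)
Definition CN01_parts (P : probability T R) (x y : {RV P >-> R}) : Prop :=
  (forall A, measurable A -> distribution P x A = normal_prob 0 (Num.sqrt (2^-1)) A) /\
  (forall A, measurable A -> distribution P y A = normal_prob 0 (Num.sqrt (2^-1)) A).

End defs.

Definition log2 {R : realType} (r : R) : R := ln r / ln 2.

Definition abs2 {R : realType} (x y : R) : R := x ^+ 2 + y ^+ 2.

(* Main.v *)
Require Import Defs.
From HB Require Import structures.
From mathcomp Require Import all_boot all_order all_algebra.
From mathcomp Require Import all_classical all_reals all_analysis.
From mathcomp Require Import measurable_realfun ring lra.
Import Order.TTheory GRing.Theory Num.Theory.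
Import numFieldNormedType.Exports.
Local Open Scope classical_set_scope.
Local Open Scope ring_scope.

(* The two links succeed independently, each when U >= a + b V for independent
   powers U = |h|^2 and V = |h'|^2. Such a power is exponential with rate 1:
   by scaling, the image of the planar Lebesgue measure under x^2 + y^2 is a
   multiple of the Lebesgue measure on [0, +oo[, and the Gaussian density
   depends on x^2 + y^2 only. Hence P(U >= a + b V) = exp(-a) / (1 + b), so that
   P_3 = 1 - K exp(-k / gamma_D) exactly, with P_3^lim = 1 - K and M_3 = k K; the
   limits follow from x / (1 + x) <= 1 - exp(-x) <= x. *)

(* The canonical measure on [pushforward] depends on a measurability proof that
   unification cannot recover, so it is passed explicitly. *)
Definition image_measure {d d' : measure_display} {T : measurableType d}
    {T' : measurableType d'} {R : realType} (m : {measure set T -> \bar R})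
    {f : T -> T'} (mf : measurable_fun setT f) : {measure set T' -> \bar R} :=
  measure_function_pushforward__canonical__measure_function_Measure m mf.

(** * Integration against a measure with a density *)

Section density.
Local Open Scope ereal_scope.
Context {d : measure_display} {T : measurableType d} {R : realType}.
Variables (mu nu : {measure set T -> \bar R}) (g : T -> R).
Hypothesis mg : measurable_fun setT g.
Hypothesis g0 : forall x, (0 <= g x)%R.
Hypothesis nuE : forall A, measurable A -> nu A = \int[mu]_(x in A) (g x)%:E.

Import HBNNSimple.

(** [nuE] is the case of indicators. Linearity gives simple functions, and monotone convergence
    along [nnsfun_approx] gives every nonnegative measurable [f]. *)
Lemma ge0_integral_density (f : T -> \bar R) :
  measurable_fun setT f -> (forall x, 0 <= f x) ->
  \int[nu]_x f x = \int[mu]_x (f x * (g x)%:E).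
Proof.
move=> mf f0; pose h := nnsfun_approx measurableT mf.
have mgE : measurable_fun setT (EFin \o g) by exact/measurable_EFinP.
have hf x : (EFin \o h n) x @[n --> \oo] --> f x.
  by apply: cvg_nnsfun_approx => // *; exact: f0.
have hnd x : nondecreasing_seq (fun n => (h n x)%:E).
  by move=> m n mn; rewrite lee_fin; exact/lefP/nd_nnsfun_approx.
transitivity (limn (fun n => \int[nu]_x (h n x)%:E)).
  rewrite -monotone_convergence//.
  - by apply: eq_integral => x _; apply/esym/cvg_lim => //; exact: hf.
  - by move=> n; exact/measurable_EFinP.
  - by move=> n x _; rewrite lee_fin.
transitivity (limn (fun n => \int[mu]_x ((h n x)%:E * (g x)%:E))); last first.
  rewrite -monotone_convergence//.
  - apply: eq_integral => x _; apply/cvg_lim => //.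
    by apply: cvgeZr => //; exact: hf.
  - by move=> n; apply: emeasurable_funM => //; exact/measurable_EFinP.
  - by move=> n x _; rewrite mule_ge0// lee_fin.
  - by move=> x _ m n mn; rewrite lee_wpmul2r ?lee_fin//; exact: hnd.
congr (limn _); apply/funext => n.
have mI r : measurable_fun setT (fun x => (r * \1_(h n @^-1` [set r]) x)%:E).
  by apply/measurable_EFinP; exact: measurable_funM.
transitivity (\sum_(r \in range (h n))
    \int[nu]_x (r * \1_(h n @^-1` [set r]) x)%:E).
  rewrite -ge0_integral_fsum//; last by move=> *; exact: nnfun_muleindic_ge0.
  by apply: eq_integral => x _; rewrite fimfunE -fsumEFin.
transitivity (\sum_(r \in range (h n))
    \int[mu]_x ((r * \1_(h n @^-1` [set r]) x)%:E * (g x)%:E)); last first.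
  rewrite -ge0_integral_fsum//; last 2 first.
  - by move=> r; exact: emeasurable_funM.
  - move=> r x _; apply: mule_ge0; last by rewrite lee_fin.
    exact: nnfun_muleindic_ge0.
  apply: eq_integral => x _; rewrite fimfunE -fsumEFin// ge0_mule_fsuml//.
  by move=> ?; exact: nnfun_muleindic_ge0.
(* Writing [r] as a value of [h n] makes it nonnegative, so it can leave the integral; what remains
   is [nu] of a level set. *)
apply: eq_fsbigr => r /[!inE] -[x _ <-].
under eq_integral do rewrite EFinM.
rewrite ge0_integralZl//; last 2 first.
- exact/measurable_EFinP/measurable_indic.
- by rewrite lee_fin.
rewrite integral_indic// setIT nuE// [X in _ * X]integral_mkcond.
rewrite -ge0_integralZl//; last 3 first.
- exact/(measurable_restrictT _ _).1/measurable_funTS.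
- by move=> *; rewrite erestrict_ge0// => *; rewrite lee_fin.
- by rewrite lee_fin.
apply: eq_integral => y _; rewrite EFinM -muleA; congr (_ * _).
by rewrite patchE indicE; case: ifPn => _; rewrite ?mul1e ?mul0e.
Qed.

End density.

(** * Lebesgue measure under dilations of the line *)

Section scaling.
Local Open Scope ereal_scope.
Context {R : realType}.
Local Notation mu := (@lebesgue_measure R).

Lemma measurable_scale (c : R) :
  measurable_fun setT (fun x : measurableTypeR R => (c * x)%R : measurableTypeR R).
Proof. exact: measurable_funM. Qed.

(** The left side is a measure in [A] that gives []a, b]] the mass [b - a], and this property
    characterizes [mu]. *)
Lemma lebesgue_measure_scale (c : R) (A : set R) : (0 < c)%R -> measurable A ->
  c%:E * mu ((fun x => c * x)%R @^-1` A) = mu A.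
Proof.
move=> c0 mA.
pose phi := fun x : measurableTypeR R => (c * x)%R : measurableTypeR R.
pose k : {nonneg R} := NngNum (ltW c0).
rewrite [RHS](@lebesgue_measure_unique R
  (mscale k (image_measure mu (measurable_scale c))))//.
move=> _ [[a b]] _ <-.
change (mu `]a, b]%classic = c%:E * mu (phi @^-1` `]a, b]%classic)).
rewrite (_ : phi @^-1` _ = `](a / c)%R, (b / c)%R]%classic); last first.
  apply/seteqP; split=> x /=; rewrite !in_itv/= ltr_pdivrMr// ler_pdivlMr//;
  by rewrite mulrC.
rewrite !lebesgue_measure_itv/= !lte_fin ltr_pM2r ?invr_gt0//.
case: ifPn => _; last by rewrite mule0.
by rewrite -!EFinD -EFinM; congr EFin; field; rewrite gt_eqF.
Qed.

Lemma ge0_integral_scale (c : R) (f : R -> \bar R) : (0 < c)%R ->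
  measurable_fun setT f -> (forall x, 0 <= f x) ->
  c%:E * \int[mu]_x f (c * x)%R = \int[mu]_x f x.
Proof.
move=> c0 mf f0.
pose k : {nonneg R} := NngNum (ltW c0).
transitivity (\int[mscale k (image_measure mu (measurable_scale c))]_x f x); last first.
  by apply: eq_measure_integral => A mA _; exact: lebesgue_measure_scale.
rewrite ge0_integral_mscale//; congr (_ * _).
by rewrite (@ge0_integral_pushforward _ _ _ _ _ _ (measurable_scale c)).
Qed.

End scaling.

(** * Planar Lebesgue measure seen through the squared norm *)

Section radial.
Local Open Scope ereal_scope.
Context {R : realType}.
Local Notation mu := (@lebesgue_measure R).
Local Notation mu2 := (mu \x mu).
Implicit Types (s : R) (A : set R).

Definition abs2_pair (z : measurableTypeR R * measurableTypeR R) :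
  measurableTypeR R := abs2 z.1 z.2.

Lemma measurable_abs2_pair : measurable_fun setT abs2_pair.
Proof. by apply: measurable_funD; apply: measurable_funX. Qed.

HB.instance Definition _ :=
  isMeasurableFun.Build _ _ _ _ abs2_pair measurable_abs2_pair.

(** The parameter bounds the squared radius, which makes the area linear in [s]; for [s <= 0] the
    disk is empty. *)
Definition disk s := abs2_pair @^-1` `]-oo, s[%classic.

Lemma measurable_disk s : measurable (disk s).
Proof. by rewrite -[disk s]setTI; exact: measurable_abs2_pair. Qed.

Lemma abs2_pair_ge0 z : (0 <= abs2_pair z)%R.
Proof. by rewrite addr_ge0// sqr_ge0. Qed.

(** Iterated integrals let a plane dilation be carried out one coordinate at a time. *)
Lemma prod_lebesgue_measureE (E : set (measurableTypeR R * measurableTypeR R)) :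
  measurable E -> mu2 E = \int[mu]_x \int[mu]_y (\1_E (x, y))%:E.
Proof.
move=> mE; rewrite -[E in LHS]setIT -integral_indic//.
by rewrite fubini_tonelli1//; exact/measurable_EFinP/measurable_indic.
Qed.

(** Dilation by [sqrt s] in each coordinate carries the unit disk onto [disk s]; each of the two
    integrals contributes one factor [sqrt s]. *)
Lemma lebesgue_disk_scale s : (0 < s)%R -> mu2 (disk s) = s%:E * mu2 (disk 1).
Proof.
move=> s0; have c0 : (0 < Num.sqrt s)%R by rewrite sqrtr_gt0.
have md s' : measurable_fun setT (fun z => (\1_(disk s') z)%:E : \bar R).
  apply/measurable_EFinP; apply: measurable_indic; exact: measurable_disk.
rewrite !prod_lebesgue_measureE; [|exact: measurable_disk..].
rewrite -(ge0_integral_scale _ _ c0); last 2 first.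
- by apply: (measurable_fun_fubini_tonelli_F _ (md s)) => z; rewrite lee_fin.
- by move=> x; apply: integral_ge0 => y _; rewrite lee_fin.
under eq_integral => x _.
  rewrite -(ge0_integral_scale _ _ c0); last 2 first.
  - exact: (measurable_fun_pair2 _ (md s)).
  - by move=> y; rewrite lee_fin.
  under eq_integral => y _.
    rewrite (_ : \1_(disk s) _ = \1_(disk 1) (x, y)); last first.
      rewrite !indicE; congr (nat_of_bool _)%:R; apply/idP/idP.
        rewrite !inE /disk /abs2_pair /abs2 /= !in_itv/= !exprMn sqr_sqrtr ?(ltW s0)//.
        by rewrite -mulrDr gtr_pMr.
      rewrite !inE /disk /abs2_pair /abs2 /= !in_itv/= !exprMn sqr_sqrtr ?(ltW s0)//.
      by rewrite -mulrDr gtr_pMr.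
    over.
  over.
rewrite ge0_integralZl//; last 2 first.
- by apply: (measurable_fun_fubini_tonelli_F _ (md 1%R)) => z; rewrite lee_fin.
- by move=> x _; apply: integral_ge0 => y _; rewrite lee_fin.
by rewrite muleA -EFinM -expr2 sqr_sqrtr// ltW.
Qed.

(** The disk lies in the square [[-1, 1]^2]. Finiteness allows the area to serve as a real scaling
    factor. *)
Lemma lebesgue_disk1_fin_num : mu2 (disk 1) \is a fin_num.
Proof.
rewrite ge0_fin_numE//.
apply: (@le_lt_trans _ _ (mu2 (`[-1, 1] `*` `[-1, 1])%R)).
  apply: le_measure; rewrite ?inE.
  - exact: measurable_disk.
  - exact: measurableX.
  - move=> [x y]; rewrite /disk /abs2_pair /abs2/= in_itv/= => xy.
    by rewrite /= !in_itv/=; split; nra.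
by rewrite product_measure1E//= lebesgue_measure_itv/= lte_fin; case: ifP => _;
  rewrite -?EFinB -?EFinM ltry.
Qed.

(* Both sides agree on the rays ]-oo, s[ by scaling, and rays form a pi-system. *)
Lemma radial_measureE A : measurable A ->
  pushforward mu2 abs2_pair A = mu2 (disk 1) * mu (A `&` `[0%R, +oo[).
Proof.
have mI : measurable (`[0%R, +oo[%classic : set (measurableTypeR R)) by [].
have k0 : (0 <= fine (mu2 (disk 1)))%R by rewrite fine_ge0.
pose k : {nonneg R} := NngNum k0.
have kE : (k%:num)%:E = mu2 (disk 1) by rewrite fineK// lebesgue_disk1_fin_num.
move=> mA; rewrite -kE.
have rayE s : pushforward mu2 abs2_pair `]-oo, s[ =
    k%:num%:E * mu (`]-oo, s[ `&` `[0%R, +oo[).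
  rewrite kE; have [s0|s0] := ltP 0%R s.
    rewrite -[LHS]/(mu2 (disk s)) lebesgue_disk_scale// muleC; congr (_ * _).
    rewrite (_ : _ `&` _ = `[0%R, s[%classic); last first.
      apply/seteqP; split => x /=; rewrite !in_itv/= andbT.
        by move=> [-> ->].
      by move=> /andP[].
    by rewrite lebesgue_measure_itv/= lte_fin s0 -EFinB subr0.
  rewrite (_ : _ `&` _ = set0); last first.
    apply/seteqP; split => x //=; rewrite !in_itv/= andbT => -[xs x0].
    by have := lt_le_trans xs s0; rewrite ltNge x0.
  rewrite measure0 mule0 -[RHS](measure0 mu2); congr (mu2 _).
  apply/seteqP; split => x //=; rewrite in_itv/= => xs.
  by have := lt_le_trans xs s0; rewrite ltNge abs2_pair_ge0.
apply: (@measure_unique _ R (measurableTypeR R) (@RGenInftyO.G R)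
  (fun n => `]-oo, n%:R[%classic) _ _ _ _
  (image_measure mu2 measurable_abs2_pair) (mscale k (mrestr mu mI))) => //.
- exact: RGenInftyO.measurableE.
- move=> _ _ [x ->] [y ->]; exists (Num.min x y).
  by apply/seteqP; split => z /=; rewrite !in_itv/= lt_min => /andP.
- by move=> n; exists n%:R.
- apply/seteqP; split => // x _; exists (Num.truncn x).+1 => //=.
  by rewrite in_itv/= truncnS_gt.
- by move=> _ [x ->]; exact: rayE.
(* Uniqueness also asks for finite mass on the exhausting rays: []-oo, n[] meets the half-line
   inside [[0, n]]. *)
- move=> n; rewrite [ltLHS]rayE kE lte_mul_pinfty// ?lebesgue_disk1_fin_num//.
  apply: (@le_lt_trans _ _ (mu `[0%R, n%:R])).
    apply: le_measure; rewrite ?inE//; first exact: measurableI.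
    by move=> x [] /=; rewrite !in_itv/= andbT => /ltW -> ->.
  by rewrite lebesgue_measure_itv/= lte_fin; case: ifP => _; rewrite -?EFinB ltry.
Qed.

(** Polar coordinates in the variable [u = x^2 + y^2]: by [radial_measureE] the image measure has
    density [mu2 (disk 1)] on the half-line and [0] elsewhere. *)
Lemma ge0_integral_radial (h : R -> \bar R) :
  measurable_fun setT h -> (forall u, 0 <= h u) ->
  \int[mu2]_z h (abs2_pair z) = mu2 (disk 1) * \int[mu]_(u in `[0%R, +oo[) h u.
Proof.
move=> mh h0; pose I : set (measurableTypeR R) := `[0%R, +oo[%classic.
have mI : measurable I by exact: measurable_itv.
have k0 : (0 <= fine (mu2 (disk 1)))%R by rewrite fine_ge0.
have kE : (fine (mu2 (disk 1)))%:E = mu2 (disk 1).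
  by rewrite fineK// lebesgue_disk1_fin_num.
rewrite -[LHS](@ge0_integral_pushforward _ _ _ _ _ _ measurable_abs2_pair mu2
  setT)//.
rewrite (@ge0_integral_density _ _ _ mu (image_measure mu2 measurable_abs2_pair)
  (fun u => fine (mu2 (disk 1)) * \1_I u)%R)//; last 3 first.
- exact: measurable_funM.
- by move=> u; rewrite mulr_ge0.
- move=> A mA; rewrite [LHS]radial_measureE// -kE.
  under eq_integral do rewrite EFinM.
  rewrite ge0_integralZl//; last first.
    exact/measurable_funTS/measurable_EFinP/measurable_indic.
  by rewrite integral_indic// setIC.
rewrite -[X in _ = X * _]kE -/I [in RHS]integral_mkcond -ge0_integralZl//; last 2 first.
- exact/(measurable_restrictT _ _).1/measurable_funTS.
- by move=> u _; rewrite erestrict_ge0.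
apply: eq_integral => u _; rewrite patchE indicE.
by case: ifPn => _; rewrite ?mulr1 ?mulr0 ?mule0// muleC.
Qed.

End radial.

(** * Squared modulus of a standard complex Gaussian *)

Section rayleigh.
Local Open Scope ereal_scope.
Context {R : realType}.
Local Notation mu := (@lebesgue_measure R).
Local Notation mu2 := (mu \x mu).
Local Notation sigma := (Num.sqrt (2^-1) : R).
Local Notation N := (@normal_prob R 0 sigma).

(** The density of [N] is used once for the outer variable and once for the mass of each section;
    Tonelli joins the two integrals. *)
Lemma prod_normal_density (E : set (measurableTypeR R * measurableTypeR R)) :
  measurable E -> (N \x N) E = \int[mu2]_z
    (\1_E z * (normal_pdf 0 sigma z.1 * normal_pdf 0 sigma z.2))%:E.
Proof.
move=> mE; pose p := @normal_pdf R 0 sigma.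
have mp : measurable_fun setT p by exact: measurable_normal_pdf.
have p0 x : (0 <= p x)%R by exact: normal_pdf_ge0.
rewrite [LHS](@ge0_integral_density _ _ _ mu N p)//; last first.
  exact: measurable_fun_xsection.
rewrite fubini_tonelli1//; last 2 first.
- apply/measurable_EFinP; apply: measurable_funM.
    exact: measurable_indic.
  by apply: measurable_funM; exact: measurableT_comp.
- by move=> z; rewrite lee_fin !mulr_ge0// normal_pdf_ge0.
apply: eq_integral => x _; rewrite /fubini_F/= /normal_prob.
rewrite integral_mkcond -ge0_integralZr//; last 3 first.
- apply/(measurable_restrictT _ _).1; first exact: measurable_xsection.
  exact/measurable_funTS/measurable_EFinP.
- by move=> y _; apply: erestrict_ge0 => z _; rewrite lee_fin.
- by rewrite lee_fin.
apply: eq_integral => y _; rewrite patchE indicE mem_xsection.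
by case: ifPn => _; rewrite ?mul0r ?mul0e// mul1r mulrC EFinM.
Qed.

(** Since [2 * sigma^2 = 1], the exponent has no denominator, and a product of two such densities is
    a function of [x^2 + y^2]. *)
Lemma normal_sigma_pdfE (x : R) :
  normal_pdf 0 sigma x = (normal_peak sigma * expR (- x ^+ 2))%R.
Proof.
have s0 : sigma != 0%R by rewrite gt_eqF// sqrtr_gt0 invr_gt0.
rewrite normal_pdfE// /normal_fun subr0 sqr_sqrtr ?invr_ge0//.
by rewrite -(mulr_natr (2^-1)) mulVf// divr1.
Qed.

(* The area of the unit disk and the normalization of the Gaussian enter only
   through one constant, which is 1 because both sides have total mass 1. *)
Lemma rayleigh_power_exponential (A : set R) : measurable A ->
  (N \x N) (abs2_pair @^-1` A) = \int[mu]_(u in A) (exponential_pdf 1 u)%:E.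
Proof.
set p2 := (normal_peak sigma ^+ 2)%R.
have law B : measurable B -> (N \x N) (abs2_pair @^-1` B) =
    mu2 (disk 1) * p2%:E * \int[mu]_(u in B) (exponential_pdf 1 u)%:E.
  move=> mB; have mB2 : measurable (abs2_pair @^-1` B).
    by rewrite -[X in measurable X]setTI; exact: measurable_abs2_pair.
  rewrite prod_normal_density//.
  have me : measurable_fun setT (fun u : R => (\1_B u * expR (- u))%R).
    apply: measurable_funM; first exact: measurable_indic.
    by apply: measurableT_comp => //; exact: measurableT_comp.
  under eq_integral => z _.
    rewrite (_ : (_ * _)%R = (p2 * (\1_B (abs2_pair z) * expR (- abs2_pair z)))%R);
      last first.
      rewrite (_ : \1_(abs2_pair @^-1` B) z = \1_B (abs2_pair z))//.
      by rewrite !normal_sigma_pdfE /abs2_pair /abs2 opprD expRD /p2; ring.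
    over.
  rewrite (@ge0_integral_radial _ (fun u => (p2 * (\1_B u * expR (- u)))%:E))//;
    last 2 first.
  - by apply/measurable_EFinP; exact: measurable_funM.
  - move=> u; rewrite lee_fin mulr_ge0 ?sqr_ge0//.
  rewrite -muleA; congr (_ * _).
  under eq_integral do rewrite EFinM.
  rewrite ge0_integralZl//; last 2 first.
  - exact/measurable_funTS/measurable_EFinP.
  - by rewrite lee_fin sqr_ge0.
  (* The half-line of integration is absorbed by [exponential_pdf], which vanishes on negative
     numbers. *)
  congr (_ * _); rewrite integral_mkcond [RHS]integral_mkcond.
  apply: eq_integral => u _; rewrite !patchE indicE /exponential_pdf patchE.
  by do 2 case: ifPn => _ //=; rewrite ?mul0r// !mul1r ?mulN1r.
move=> mA; suff k1 : mu2 (disk 1) * p2%:E = 1 by rewrite law// k1 mul1e.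
have := law _ measurableT; rewrite preimage_setT integral_exponential_pdf// mule1.
by move=> <-; exact: probability_setT.
Qed.

End rayleigh.

(** * Joint law of two variables in the presence of a further event *)

Section independent_pair.
Local Open Scope ereal_scope.

(** Measurable rectangles form a pi-system generating the product sigma-algebra; as [m1] is finite,
    the constant sequence [setT] is an admissible exhaustion. *)
Lemma eq_measure_rectangles {d1 d2 : measure_display} {T1 : measurableType d1}
    {T2 : measurableType d2} {R : realType}
    (m1 m2 : {measure set (T1 * T2) -> \bar R}) : m1 setT < +oo ->
    (forall A B, measurable A -> measurable B -> m1 (A `*` B) = m2 (A `*` B)) ->
  forall E, measurable E -> m1 E = m2 E.
Proof.
move=> m1oo m12 E mE.
pose G : set (set (T1 * T2)) :=
  [set A `*` B | A in measurable & B in measurable].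
apply: (measure_unique G (fun=> setT)) => //.
- exact: measurable_prod_measurableType.
- move=> _ _ [A1 mA1 [B1 mB1 <-]] [A2 mA2 [B2 mB2 <-]].
  exists (A1 `&` A2); first exact: measurableI.
  by exists (B1 `&` B2); [exact: measurableI|rewrite setXI].
- by move=> _; exists setT => //; exists setT => //; rewrite setXTT.
- by rewrite bigcup_const//; exists 0%N.
- by move=> _ [A mA [B mB <-]]; exact: m12.
Qed.

Context {d d1 d2 : measure_display} {T : measurableType d}
  {T1 : measurableType d1} {T2 : measurableType d2} {R : realType}.
Variables (P : probability T R) (m1 : probability T1 R) (m2 : probability T2 R).
Variables (X : T -> T1) (Y : T -> T2).
Hypotheses (mX : measurable_fun setT X) (mY : measurable_fun setT Y).

(* Taking [A = B = setT] in the hypothesis shows that [c = P C]. *)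
Lemma independent_pair (C : set T) (c : \bar R) : measurable C ->
    (forall A B, measurable A -> measurable B ->
      P (X @^-1` A `&` (Y @^-1` B `&` C)) = m1 A * (m2 B * c)) ->
  forall E, measurable E ->
    P ((fun w => (X w, Y w)) @^-1` E `&` C) = (m1 \x m2) E * c.
Proof.
move=> mC H; have PC : c = P C.
  have := H _ _ measurableT measurableT.
  by rewrite !preimage_setT !setTI !probability_setT !mul1e.
have k0 : (0 <= fine (P C))%R by exact: fine_ge0.
pose k : {nonneg R} := NngNum k0.
have kE : k%:num%:E = c by rewrite PC fineK// fin_num_measure.
move=> E mE; rewrite -kE muleC.
(* The two measures compared are [P] restricted to [C] and pushed forward by the pair, and the
   product law scaled by [c]; [H] is their equality on rectangles. *)
apply: (@eq_measure_rectangles _ _ _ _ _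
  (image_measure (mrestr P mC) (measurable_fun_pair mX mY))
  (mscale k (m1 \x m2))) => //.
  change (P ((fun w => (X w, Y w)) @^-1` setT `&` C) < +oo).
  by rewrite preimage_setT setTI -PC -kE ltry.
move=> A B mA mB.
change (P ((fun w => (X w, Y w)) @^-1` (A `*` B) `&` C) =
  k%:num%:E * (m1 \x m2) (A `*` B)).
rewrite product_measure1E// kE muleC -muleA.
by rewrite -H//; congr (P _); rewrite setIA.
Qed.

End independent_pair.

(** * The exponential law and the success probability of one link *)

Section rayleigh_power.
Local Open Scope ereal_scope.
Context {R : realType}.
Local Notation mu := (@lebesgue_measure R).
Local Notation N := (@normal_prob R 0 (Num.sqrt 2^-1)).

(** Defined as the image of a Gaussian pair, it is a probability by construction; [rayleigh_powerE]
    identifies it with the exponential law of rate 1. *)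
Definition rayleigh_power : probability (measurableTypeR R) R :=
  distribution (N \x N) abs2_pair.

Lemma rayleigh_powerE A : measurable A ->
  rayleigh_power A = \int[mu]_(u in A) (exponential_pdf 1 u)%:E.
Proof. exact: rayleigh_power_exponential. Qed.

Lemma exponential_tail (w : R) : (0 <= w)%R ->
  \int[mu]_(u in `[w, +oo[) (exponential_pdf 1 u)%:E = (expR (- w))%:E.
Proof.
(* [F] is an antiderivative of the density with limit [0] at infinity. The factor [- 1] is minus the
   rate, kept visible for [derive1_exponential_pdf]. *)
move=> w0; pose F (x : R) := (- expR (- 1 * x))%R.
have FE : F = (fun x => - expR (- x))%R.
  by apply/funext => x; rewrite /F mulN1r.
rewrite (@ge0_continuous_FTC2y _ _ F _ 0)//.
- by rewrite FE EFinN oppeK add0e.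
- by move=> x _; exact: exponential_pdf_ge0.
- apply: (@continuous_subspaceW R^o _ _ [set` `[0, +oo[%R]).
    by apply: subset_itvr; rewrite bnd_simp.
  exact: within_continuous_exponential_pdf.
- by rewrite FE -oppr0; apply: cvgN; exact: cvgr_expR.
- rewrite FE; apply: cvgN; apply/cvg_at_right_filter.
  apply: continuous_comp; last exact: continuous_expR.
  exact: continuousN.
- move=> x; rewrite in_itv/= andbT => wx.
  by apply: derive1_exponential_pdf; rewrite in_itv/= andbT (le_lt_trans w0).
Qed.

(** Given [z.1 = v], the event has probability [exp(- a - b v)]. Times the density [exp(- v)], this
    is [exp(- a) / (1 + b)] times the exponential density of rate [1 + b], whose integral is 1. *)
Lemma prod_rayleigh_power_affine (a b : R) : (0 <= a)%R -> (0 <= b)%R ->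
  (rayleigh_power \x rayleigh_power) [set z | a + b * z.1 <= z.2]%R =
  (expR (- a) / (1 + b))%:E.
Proof.
move=> a0 b0; set E := [set _ | _].
have mE : measurable E.
  rewrite -[E]setTI; apply: measurable_fun_le => //.
  by apply: measurable_funD => //; exact: measurable_funM.
have b1 : (0 < 1 + b)%R by rewrite ltr_wpDr.
rewrite [LHS](@ge0_integral_density _ _ _ mu rayleigh_power (exponential_pdf 1))//;
  last 4 first.
- exact: measurable_exponential_pdf.
- by move=> x; exact: exponential_pdf_ge0.
- by move=> A mA; exact: rayleigh_powerE.
- exact: measurable_fun_xsection.
transitivity (\int[mu]_v ((expR (- a) / (1 + b))%:E *
    (exponential_pdf (1 + b) v)%:E)); last first.
  have c0 : (0 <= expR (- a) / (1 + b))%R.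
    by apply: divr_ge0; [exact: expR_ge0|exact: ltW].
  rewrite ge0_integralZl//.
  - by rewrite integral_exponential_pdf// mule1.
  - by apply/measurable_EFinP; exact: measurable_exponential_pdf.
  - by move=> v _; rewrite lee_fin; apply: exponential_pdf_ge0; exact: ltW.
(* Both densities vanish at negative [v]; for [v >= 0] the threshold [a + b * v] is nonnegative, as
   [exponential_tail] requires. *)
apply: eq_integral => v _; have [v0|v0] := leP 0%R v; last first.
  by rewrite !lt0_exponential_pdf// !mule0.
change (rayleigh_power (xsection E v) * (exponential_pdf 1 v)%:E =
  (expR (- a) / (1 + b))%:E * (exponential_pdf (1 + b) v)%:E).
rewrite (_ : xsection E v = `[(a + b * v)%R, +oo[%classic); last first.
  by apply/seteqP; split => u; rewrite /xsection/= inE /E/= in_itv/= andbT.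
rewrite rayleigh_powerE// exponential_tail; last by rewrite addr_ge0// mulr_ge0.
rewrite !exponential_pdfE// -!EFinM; congr EFin.
rewrite mul1r mulrA divfK ?gt_eqF// -!expRD; congr expR; ring.
Qed.

End rayleigh_power.

(** * From eight independent Gaussians to two independent links *)

Section outage.
Context {R : realType} {d : measure_display} {T : measurableType d}.
Variable P : probability T R.
Local Notation N := (@normal_prob R 0 (Num.sqrt 2^-1)).
Local Notation Ex := (@rayleigh_power R).

Lemma measurable_abs2 (x y : {RV P >-> R}) :
  measurable_fun setT (fun w => abs2 (x w) (y w)).
Proof. by apply: measurable_funD; exact: measurable_funX. Qed.

(** Merges two coordinates into one power while [C] holds the events on all other variables, so that
    it can be applied repeatedly. *)
Lemma independent_power (x y : {RV P >-> R}) (C : set T) (c : \bar R) :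
    measurable C ->
    (forall A B, measurable A -> measurable B ->
      (P (x @^-1` A `&` (y @^-1` B `&` C)) = N A * (N B * c))%E) ->
  forall B, measurable B ->
    (P ((fun w => abs2 (x w) (y w)) @^-1` B `&` C) = Ex B * c)%E.
Proof.
move=> mC H B mB.
apply: (@independent_pair _ _ _ _ _ _ _ P N N x y
  (measurable_funPT x) (measurable_funPT y) C c mC H
  (abs2_pair @^-1` B)) => //.
by rewrite -[X in measurable X]setTI; exact: measurable_abs2_pair.
Qed.

Lemma independent_eight (x0 x1 x2 x3 x4 x5 x6 x7 : {RV P >-> R})
    (A0 A1 A2 A3 A4 A5 A6 A7 : set R) :
  mutually_independent P [:: (x0 : T -> R); (x1 : T -> R); (x2 : T -> R);
    (x3 : T -> R); (x4 : T -> R); (x5 : T -> R); (x6 : T -> R); (x7 : T -> R)] ->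
  measurable A0 -> measurable A1 -> measurable A2 -> measurable A3 ->
  measurable A4 -> measurable A5 -> measurable A6 -> measurable A7 ->
  (P (x0 @^-1` A0 `&` (x1 @^-1` A1 `&` (x2 @^-1` A2 `&` (x3 @^-1` A3 `&`
     (x4 @^-1` A4 `&` (x5 @^-1` A5 `&` (x6 @^-1` A6 `&` x7 @^-1` A7))))))) =
  P (x0 @^-1` A0) * (P (x1 @^-1` A1) * (P (x2 @^-1` A2) * (P (x3 @^-1` A3) *
  (P (x4 @^-1` A4) * (P (x5 @^-1` A5) * (P (x6 @^-1` A6) * P (x7 @^-1` A7))))))))%E.
Proof.
move=> H m0 m1 m2 m3 m4 m5 m6 m7.
have := H (nth setT [:: A0; A1; A2; A3; A4; A5; A6; A7]).
rewrite bigcap_mkord !big_ord_recl !big_ord0 /= setIT mule1; apply.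
(* Indices past the list receive the default [setT], which is measurable. *)
by do 8 (case=> //); move=> n; rewrite nth_default.
Qed.

Section links.
Variables xSR ySR xRD yRD xSE ySE xRE yRE : {RV P >-> R}.
Hypothesis indep :
  mutually_independent P [:: (xSR : T -> R); (ySR : T -> R); (xRD : T -> R);
     (yRD : T -> R); (xSE : T -> R); (ySE : T -> R); (xRE : T -> R); (yRE : T -> R)].
Hypotheses (cnSR : CN01_parts xSR ySR) (cnRD : CN01_parts xRD yRD)
  (cnSE : CN01_parts xSE ySE) (cnRE : CN01_parts xRE yRE).

Let uSR w := abs2 (xSR w) (ySR w).
Let uRD w := abs2 (xRD w) (yRD w).
Let uSE w := abs2 (xSE w) (ySE w).
Let uRE w := abs2 (xRE w) (yRE w).

Let mpre (f : T -> R) A : measurable_fun setT f -> measurable A ->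
  measurable (f @^-1` A).
Proof. by move=> mf mA; rewrite -[X in measurable X]setTI; exact: mf. Qed.

Let mpreX (f : {RV P >-> R}) A : measurable A -> measurable (f @^-1` A).
Proof. exact: mpre. Qed.

Let mpreU (x y : {RV P >-> R}) A : measurable A ->
  measurable ((fun w => abs2 (x w) (y w)) @^-1` A).
Proof. by apply: mpre; exact: measurable_abs2. Qed.

(** The coordinates are merged pair by pair, in the order SR, RD, SE, RE. The conclusion places each
    eavesdropper power next to its link, as [probability_links] uses them. *)
Lemma independent_powers (B1 B2 B3 B4 : set R) : measurable B1 ->
  measurable B2 -> measurable B3 -> measurable B4 ->
  (P (uSE @^-1` B3 `&` (uSR @^-1` B1 `&` (uRE @^-1` B4 `&` uRD @^-1` B2))) =
  Ex B3 * (Ex B1 * (Ex B4 * Ex B2)))%E.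
Proof.
move=> mB1 mB2 mB3 mB4.
have law (x y : {RV P >-> R}) A : CN01_parts x y -> measurable A ->
    P (x @^-1` A) = N A /\ P (y @^-1` A) = N A.
  by move=> [lx ly] mA; split; [exact: lx|exact: ly].
have h0 A0 A1 A2 A3 A4 A5 A6 A7 := @independent_eight
  _ _ _ _ _ _ _ _ A0 A1 A2 A3 A4 A5 A6 A7 indep.
have h1 A2 A3 A4 A5 A6 A7 : measurable A2 -> measurable A3 ->
    measurable A4 -> measurable A5 -> measurable A6 -> measurable A7 ->
    (P (uSR @^-1` B1 `&` (xRD @^-1` A2 `&` (yRD @^-1` A3 `&` (xSE @^-1` A4 `&`
      (ySE @^-1` A5 `&` (xRE @^-1` A6 `&` yRE @^-1` A7)))))) =
    Ex B1 * (N A2 * (N A3 * (N A4 * (N A5 * (N A6 * N A7))))))%E.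
  move=> m2 m3 m4 m5 m6 m7; apply: independent_power => //.
    by repeat apply: measurableI; exact: mpreX.
  move=> A B mA mB; rewrite (h0 _ _ _ _ _ _ _ _ mA mB m2 m3 m4 m5 m6 m7).
  rewrite (law _ _ _ cnSR mA).1 (law _ _ _ cnSR mB).2.
  rewrite (law _ _ _ cnRD m2).1 (law _ _ _ cnRD m3).2.
  rewrite (law _ _ _ cnSE m4).1 (law _ _ _ cnSE m5).2.
  by rewrite (law _ _ _ cnRE m6).1 (law _ _ _ cnRE m7).2.
have h2 A4 A5 A6 A7 : measurable A4 -> measurable A5 ->
    measurable A6 -> measurable A7 ->
    (P (uRD @^-1` B2 `&` (xSE @^-1` A4 `&` (ySE @^-1` A5 `&`
      (xRE @^-1` A6 `&` (yRE @^-1` A7 `&` uSR @^-1` B1))))) =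
    Ex B2 * (N A4 * (N A5 * (N A6 * (N A7 * Ex B1)))))%E.
  move=> m4 m5 m6 m7; apply: independent_power => //.
    by repeat apply: measurableI; first [exact: mpreX|exact: mpreU].
  move=> A B mA mB.
  (* The last event, on [uSR], is rotated to the front, where [h1] has it; the factors are rotated
     likewise. *)
  rewrite !setIA setIC -!setIA (h1 _ _ _ _ _ _ mA mB m4 m5 m6 m7).
  by rewrite [LHS]muleC -!muleA.
have h3 A6 A7 : measurable A6 -> measurable A7 ->
    (P (uSE @^-1` B3 `&` (xRE @^-1` A6 `&` (yRE @^-1` A7 `&`
      (uSR @^-1` B1 `&` uRD @^-1` B2)))) =
    Ex B3 * (N A6 * (N A7 * (Ex B1 * Ex B2))))%E.
  move=> m6 m7; apply: independent_power => //.
    by repeat apply: measurableI; first [exact: mpreX|exact: mpreU].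
  move=> A B mA mB; rewrite !setIA setIC -!setIA (h2 _ _ _ _ mA mB m6 m7).
  by rewrite [LHS]muleC -!muleA.
rewrite [X in _ `&` X]setICA setICA.
rewrite [X in (_ = X)%E](_ : _ = Ex B4 * (Ex B3 * (Ex B1 * Ex B2)))%E; last first.
  by rewrite [RHS]muleCA [X in (_ = _ * X)%E]muleCA.
apply: independent_power => //.
  by repeat apply: measurableI; exact: mpreU.
move=> A B mA mB.
rewrite (_ : (N A * (N B * _) = Ex B3 * (N A * (N B * (Ex B1 * Ex B2))))%E);
  last by rewrite [RHS]muleCA [X in (_ = _ * X)%E]muleCA.
rewrite -(h3 _ _ mA mB); congr (P _).
by rewrite [RHS]setICA [X in _ = _ `&` X]setICA.
Qed.

Let mU (x y : {RV P >-> R}) :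
  measurable_fun setT (fun w => abs2 (x w) (y w) : measurableTypeR R).
Proof. exact: measurable_abs2. Qed.

Let affine a b : set (measurableTypeR R * measurableTypeR R) :=
  [set z | a + b * z.1 <= z.2].

Let measurable_affine a b : measurable (affine a b).
Proof.
rewrite -[affine a b]setTI; apply: measurable_fun_le => //.
by apply: measurable_funD => //; exact: measurable_funM.
Qed.

(** [independent_pair] is applied twice: to the first link with events on [uRE] and [uRD] as [C],
    then to the second link with the success of the first as [C]. *)
Lemma probability_links (a b a' b' : R) :
  0 <= a -> 0 <= b -> 0 <= a' -> 0 <= b' ->
  P ([set w | a + b * uSE w <= uSR w] `&` [set w | a' + b' * uRE w <= uRD w]) =
  ((expR (- a) / (1 + b)) * (expR (- a') / (1 + b')))%:E.
Proof.
move=> a0 b0 a'0 b'0.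
have h1 B4 B2 : measurable B4 -> measurable B2 ->
    (P ((fun w => (uSE w, uSR w)) @^-1` affine a b `&`
        (uRE @^-1` B4 `&` uRD @^-1` B2)) =
    (Ex \x Ex) (affine a b) * (Ex B4 * Ex B2))%E.
  move=> m4 m2; apply: (@independent_pair _ _ _ _ _ _ _ P Ex Ex uSE uSR) => //.
  - exact: mU.
  - exact: mU.
  - by apply: measurableI; exact: mpreU.
  - by move=> B3 B1 m3 m1; exact: independent_powers.
have h2 : (P ((fun w => (uRE w, uRD w)) @^-1` affine a' b' `&`
      (fun w => (uSE w, uSR w)) @^-1` affine a b) =
    (Ex \x Ex) (affine a' b') * (Ex \x Ex) (affine a b))%E.
  apply: (@independent_pair _ _ _ _ _ _ _ P Ex Ex uRE uRD) => //.
  - exact: mU.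
  - exact: mU.
  - rewrite -[X in measurable X]setTI.
    by apply: (measurable_fun_pair (mU xSE ySE) (mU xSR ySR)).
  - move=> B4 B2 m4 m2.
    by rewrite setIA setIC (h1 _ _ m4 m2) [LHS]muleC -muleA.
rewrite setIC -[LHS]/(P ((fun w => (uRE w, uRD w)) @^-1` affine a' b' `&`
      (fun w => (uSE w, uSR w)) @^-1` affine a b)).
by rewrite h2 muleC !prod_rayleigh_power_affine// -EFinM.
Qed.

End links.
End outage.

(** * Limits of [exp(- k / t)] at infinity *)

Section asymptotics.
Context {R : realType}.

Lemma cvg_const_div_pinfty (k : R) : k / t @[t --> +oo] --> 0.
Proof.
rewrite -[X in _ --> X](mulr0 k); apply: cvgM; first exact: cvg_cst.
by apply/gtr0_cvgV0 => //; exact: nbhs_pinfty_gt.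
Qed.

Lemma cvg_expRN_div_pinfty (k : R) : expR (- (k / t)) @[t --> +oo] --> (1 : R).
Proof.
rewrite -[X in _ --> X](@expR0 R) -oppr0.
apply: (continuous_cvg _ (@continuous_expR R _)).
by apply: cvgN; exact: cvg_const_div_pinfty.
Qed.

(** Squeezed between [k / (1 + k / t)] and [k]; both bounds come from [1 + x <= exp(x)], at
    [x = k / t] and at [x = - k / t]. *)
Lemma cvg_mulr_1subexpRN_pinfty (k : R) : 0 <= k ->
  t * (1 - expR (- (k / t))) @[t --> +oo] --> k.
Proof.
move=> k0.
apply: (@squeeze_cvgr _ _ _ _ (fun t => k / (1 + k / t)) (fun=> k)).
- near=> t; have t0 : 0 < t by near: t; exact: nbhs_pinfty_gt.
  have kt : 0 <= k / t by rewrite divr_ge0// ltW.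
  have kt1 : 0 < 1 + k / t by rewrite ltr_wpDr.
  have tk : t * (k / t) = k by field; rewrite gt_eqF.
  apply/andP; split.
    rewrite -[X in X / _]tk -mulrA ler_pM2l//.
    rewrite (_ : k / t / (1 + k / t) = 1 - (1 + k / t)^-1); last first.
      rewrite -[X in _ - X]mul1r -[X in X - _](divff (lt0r_neq0 kt1)) -mulrBl.
      by rewrite addrAC subrr add0r.
    by rewrite lerB// expRN lef_pV2 ?posrE ?expR_gt0// expR_ge1Dx.
  by rewrite -[leRHS]tk ler_pM2l// lerBlDr -lerBlDl expR_ge1Dx.
- rewrite -[X in _ --> X]divr1; apply: cvgM; first exact: cvg_cst.
  apply: cvgV => //.
  rewrite -[X in _ --> X]addr0; apply: cvgD; first exact: cvg_cst.
  exact: cvg_const_div_pinfty.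
- exact: cvg_cst.
Unshelve. all: by end_near. Qed.

End asymptotics.

(** * Rate thresholds as affine inequalities between powers *)

Section secrecy_rate.
Context {R : realType}.

(** The logarithm is increasing and the denominator positive; solving for [u] gives the affine form
    [a + b * v <= u] whose probability is known. *)
Lemma le_log2_ratio (Rs g e u v : R) : 0 < g -> 0 <= e -> 0 <= u -> 0 <= v ->
  (Rs <= log2 ((1 + g * u) / (1 + e * v))) =
  ((2 `^ Rs - 1) / g + 2 `^ Rs * e / g * v <= u).
Proof.
move=> g0 e0 u0 v0.
have ev : 0 < 1 + e * v by rewrite ltr_wpDr// mulr_ge0.
have gu : 0 < 1 + g * u by rewrite ltr_wpDr// mulr_ge0// ltW.
have ln2 : 0 < ln (2 : R) by rewrite ln_gt0// ltr1n.
rewrite /log2 ler_pdivlMr// -ln_powR ler_ln ?posrE ?powR_gt0 ?divr_gt0//.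
rewrite ler_pdivlMr//.
rewrite (_ : _ / g + _ = (2 `^ Rs * (1 + e * v) - 1) / g); last first.
  by field; rewrite gt_eqF.
by rewrite ler_pdivrMr// lerBlDl (mulrC u).
Qed.

End secrecy_rate.

(** * Closed form of the outage probability and its expansion *)

Theorem theorem9 (R : realType) (d : measure_display) (T : measurableType d)
  (P : probability T R)
  (xSR ySR xRD yRD xSE ySE xRE yRE : {RV P >-> R})
  (Rs alpha beta : R) :
  0 < Rs -> 0 < alpha -> 0 < beta ->
  mutually_independent P [:: (xSR : T -> R); (ySR : T -> R); (xRD : T -> R);
     (yRD : T -> R); (xSE : T -> R); (ySE : T -> R); (xRE : T -> R); (yRE : T -> R)] ->
  CN01_parts xSR ySR -> CN01_parts xRD yRD ->
  CN01_parts xSE ySE -> CN01_parts xRE yRE ->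
  let gR gD := alpha * gD in
  let gE gD := gR gD / beta in
  let RSR gD w := log2 ((1 + gR gD * abs2 (xSR w) (ySR w)) /
                        (1 + gE gD * abs2 (xSE w) (ySE w))) in
  let RRD gD w := log2 ((1 + gD * abs2 (xRD w) (yRD w)) /
                        (1 + gE gD * abs2 (xRE w) (yRE w))) in
  let R3 gD w := Num.max (Num.min (RSR gD w) (RRD gD w)) 0 in
  let P3 gD := fine (P [set w | R3 gD w < Rs]) in
  let Plim := 1 - beta / (beta + alpha * 2 `^ Rs) * (beta / (beta + 2 `^ Rs)) in
  let M3 := (2 `^ Rs - 1) * (1 + 1 / alpha) /
            ((1 + alpha / beta * 2 `^ Rs) * (1 + 1 / beta * 2 `^ Rs)) in
  (P3 gD @[gD --> +oo] --> Plim) /\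
  (gD * (P3 gD - Plim) @[gD --> +oo] --> M3).
Proof.
move=> Rs0 alpha0 beta0 indep cnSR cnRD cnSE cnRE gR gE RSR RRD R3 P3 Plim M3.
set c := 2 `^ Rs in Plim M3 *.
have c1 : 1 <= c by rewrite /c -[leLHS](@powRr0 _ 2) ler_powR ?ler1n// ltW.
have c0 : 0 < c by exact: lt_le_trans c1.
(* These are chosen so that [a + a' = k / g] and [K = 1 / ((1 + b) * (1 + b'))] for the thresholds
   below; then [Plim = 1 - K] and [M3 = k * K]. *)
pose k := (c - 1) * (1 + 1 / alpha).
pose K := beta / (beta + alpha * c) * (beta / (beta + c)).
have k0 : 0 <= k by rewrite mulr_ge0 ?subr_ge0// addr_ge0// divr_ge0// ltW.
have P3E g : 0 < g -> P3 g = 1 - expR (- (k / g)) * K.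
  (* Thresholds from [le_log2_ratio]. The slopes [b] and [b'] do not depend on [g], because all
     average SNRs grow in proportion; hence the nonzero outage floor. *)
  move=> g0; pose a := (c - 1) / (alpha * g); pose b := c / beta.
  pose a' := (c - 1) / g; pose b' := c * alpha / beta.
  have ag : 0 < alpha * g by exact: mulr_gt0.
  have eg : 0 <= alpha * g / beta by rewrite divr_ge0 ?ltW.
  pose S := [set w | a + b * abs2 (xSE w) (ySE w) <= abs2 (xSR w) (ySR w)] `&`
    [set w | a' + b' * abs2 (xRE w) (yRE w) <= abs2 (xRD w) (yRD w)].
  have mle (f h : T -> R) : measurable_fun setT f -> measurable_fun setT h ->
      measurable [set w | f w <= h w].
    by move=> mf mh; rewrite -[X in measurable X]setTI; exact: measurable_fun_le.
  have mS : measurable S.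
    apply: measurableI; apply: mle; try exact: measurable_abs2;
    by apply: measurable_funD => //; apply: measurable_funM => //;
       exact: measurable_abs2.
  have SE : [set w | R3 g w < Rs] = ~` S.
    rewrite -[LHS]setCK; congr (~` _); apply/seteqP.
    (* As [0 < Rs], the maximum with [0] reaches [Rs] only through the minimum, that is, when both
       links do. *)
    have ge w : (Rs <= R3 g w) = (Rs <= RSR g w) && (Rs <= RRD g w).
      by rewrite /R3 le_max le_min [Rs <= 0]leNgt Rs0 orbF.
    have SRE w : (Rs <= RSR g w) =
        (a + b * abs2 (xSE w) (ySE w) <= abs2 (xSR w) (ySR w)).
      rewrite /RSR le_log2_ratio ?addr_ge0 ?sqr_ge0// -/c.
      congr (_ + _ * _ <= _); rewrite /b /gE /gR; field.
      by rewrite !gt_eqF.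
    have RDE w : (Rs <= RRD g w) =
        (a' + b' * abs2 (xRE w) (yRE w) <= abs2 (xRD w) (yRD w)).
      rewrite /RRD le_log2_ratio ?addr_ge0 ?sqr_ge0// -/c.
      congr (_ + _ * _ <= _); rewrite /b' /gE /gR; field.
      by rewrite !gt_eqF.
    split=> w /=.
      by move/negP; rewrite -leNgt ge SRE RDE => /andP.
    by move=> /andP; rewrite -SRE -RDE -ge leNgt => /negP.
  rewrite /P3 SE probability_setC// probability_links//.
  - rewrite -EFinB/= -/c; congr (1 - _).
    rewrite mulrACA -expRD /K; congr (expR _ * _).
      by rewrite /a /a' /k; field; rewrite !gt_eqF.
    by rewrite /b /b'; field; rewrite !gt_eqF// addr_gt0// mulr_gt0.
  - by rewrite divr_ge0 ?subr_ge0// ltW.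
  - by rewrite divr_ge0 ?ltW.
  - by rewrite divr_ge0 ?subr_ge0// ltW.
  - by rewrite divr_ge0 ?mulr_ge0 ?ltW.
(* The closed form is known for [0 < g], which holds eventually. *)
have near_pos (f h : R -> R) (l : R) : (forall g, 0 < g -> f g = h g) ->
    h g @[g --> +oo] --> l -> f g @[g --> +oo] --> l.
  move=> fh; apply: cvg_trans; apply: near_eq_cvg.
  by near=> g; apply/esym/fh; near: g; exact: nbhs_pinfty_gt.
split.
  apply: (near_pos _ _ _ P3E); apply: cvgB; first exact: cvg_cst.
  rewrite -[X in _ --> X]mul1r; apply: cvgM; last exact: cvg_cst.
  exact: cvg_expRN_div_pinfty.
(* Here [P3 g - Plim] is exactly [(1 - exp(- k / g)) * K]. *)
apply: (near_pos _ (fun g => g * (1 - expR (- (k / g))) * K)).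
  by move=> g g0; rewrite P3E// /Plim -/K; ring.
rewrite (_ : M3 = k * K).
  by apply: cvgM; [exact: cvg_mulr_1subexpRN_pinfty|exact: cvg_cst].
rewrite /M3 /k /K; field.
by rewrite !gt_eqF// ?addr_gt0// mulr_gt0.
Unshelve. all: by end_near. Qed.
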